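(* Let $\kappa$ be an uncountable regular cardinal with $\kappa^{<\kappa}=\kappa$. Suppose $1\le\gamma\le\kappa$ and $\chi_i$, $i<\gamma$, are nonzero cardinals such that for each $i<\gamma$, $\phi_i$ defines a $\Sigma^1_1$-equivalence relation on ${}^\kappa2$ with the parameter $R_i\subseteq H(\kappa)$ and it has exactly $\chi_i$ equivalence classes. (i) There exists a $\Sigma^1_1$-equivalence relation on ${}^\kappa2$ with exactly $\bigcup_{i<\gamma}\chi_i$ equivalence classes. (ii) There exists a $\Sigma^1_1$-equivalence relation on ${}^\kappa2$ with exactly $\left|\prod_{i<\gamma}\chi_i\right|$ equivalence classes.
   Context: ${}^\kappa2$ is the set of functions from $\kappa$ to $2$; $H(\kappa)$ is the set of all sets whose transitive closure has cardinality $<\kappa$. A first order sentence $\phi$ in the vocabulary consisting of $\in$, a unary relation symbol $S_0$ and binary relation symbols $S_1,S_2,S_3$ defines a $\Sigma^1_1$-equivalence relation $\sim_{\phi,R}$ on ${}^\kappa2$ with a parameter $R\subseteq H(\kappa)$ if the following gives an equivalence relation on ${}^\kappa 2$: for $f,g\in{}^\kappa2$, $f\sim_{\phi,R}g$ iff for some $h\in{}^\kappa2$, $\langle H(\kappa),\in,R,f,g,h\rangle\models\phi$, where $R,f,g,h$ interpret $S_0,S_1,S_2,S_3$ respectively. A $\Sigma^1_1$-equivalence relation on ${}^\kappa2$ is one of the form $\sim_{\phi,R}$ for some such $\phi$ and $R$. The union of a set of cardinals is its supremum. *)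

(* Defs.v *)
From HB Require Import structures.
From mathcomp Require Import all_boot.
From mathcomp Require Import generic_quotient boolp classical_sets functions cardinality.
From Stdlib Require Import RelationClasses.

Set Implicit Arguments.
Unset Strict Implicit.
Unset Printing Implicit Defensive.

Local Open Scope classical_set_scope.
Local Open Scope card_scope.

(* [V] is Aczel's type of well-founded trees modulo bisimulation; with the
   classical axioms of [boolp] it is a model of ZFC in which set equality is
   Leibniz equality. *)

Inductive ens : Type := Sup (A : Type) (F : A -> ens).

Fixpoint ens_eq (x y : ens) : Prop :=
  match x, y with
  | Sup A F, Sup B G =>
      (forall a, exists b, ens_eq (F a) (G b)) /\
      (forall b, exists a, ens_eq (F a) (G b))
  end.

Definition ens_mem (x y : ens) : Prop :=
  let: Sup B G := y in exists b, ens_eq x (G b).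

Lemma ens_eq_refl x : ens_eq x x.
Proof. by elim: x => A F IH /=; split=> a; exists a. Qed.

Lemma ens_eq_sym x y : ens_eq x y -> ens_eq y x.
Proof.
elim: x y => A F IH [B G] /= [h1 h2]; split=> [b|a].
- by have [a ha] := h2 b; exists a; apply: IH.
- by have [b hb] := h1 a; exists b; apply: IH.
Qed.

Lemma ens_eq_trans x y z : ens_eq x y -> ens_eq y z -> ens_eq x z.
Proof.
elim: x y z => A F IH [B G] [C K] /= [h1 h2] [k1 k2]; split=> [a|c].
- by have [b hb] := h1 a; have [c hc] := k1 b; exists c; apply: IH hc.
- by have [b hb] := k2 c; have [a ha] := h2 b; exists a; apply: IH hb.
Qed.

HB.instance Definition _ := gen_eqMixin ens.
HB.instance Definition _ := gen_choiceMixin ens.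

Definition ens_eqb (x y : ens) : bool := `[< ens_eq x y >].

Lemma ens_eqb_refl : reflexive ens_eqb.
Proof. by move=> x; apply/asboolP/ens_eq_refl. Qed.

Lemma ens_eqb_sym : symmetric ens_eqb.
Proof. by move=> x y; apply/asboolP/asboolP; apply: ens_eq_sym. Qed.

Lemma ens_eqb_trans : transitive ens_eqb.
Proof.
by move=> y x z /asboolP xy /asboolP yz; apply/asboolP/(ens_eq_trans xy yz).
Qed.

Canonical ens_equiv := EquivRel ens_eqb ens_eqb_refl ens_eqb_sym ens_eqb_trans.

Definition V : Type := {eq_quot ens_equiv}%qT.

Definition mkV (x : ens) : V := (\pi_({eq_quot ens_equiv}%qT) x)%qT.

Definition vmem (x y : V) : Prop := ens_mem (repr x) (repr y).

Definition elts (x : V) : set V := [set y | vmem y x].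

Lemma mkV_eqP x y : mkV x = mkV y <-> ens_eq x y.
Proof.
split=> [/eqmodP/asboolP//|xy]; apply/eqmodP; exact/asboolP.
Qed.

Lemma repr_mkV x : ens_eq (repr (mkV x)) x.
Proof. by apply/mkV_eqP; rewrite /mkV reprK. Qed.

Lemma elts_mkV (A : Type) (F : A -> ens) (x : V) :
  elts (mkV (Sup F)) x <-> exists a, x = mkV (F a).
Proof.
rewrite /elts /vmem /=; have := repr_mkV (Sup F).
case: (repr _) => B G /= [h1 h2]; split.
- case=> b xb; have [a ab] := h1 b; exists a.
  rewrite -[x]reprK; apply/mkV_eqP; exact: ens_eq_trans ab.
- case=> a ->; have [b ba] := h2 a; exists b.
  by apply: ens_eq_trans (repr_mkV _) _; apply: ens_eq_sym.
Qed.

Lemma V_ext (x y : V) : elts x = elts y -> x = y.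
Proof.
rewrite -[x]reprK -[y]reprK -/(mkV _) -/(mkV (repr y)).
case: (repr x) (repr y) => A F [B G] e; apply/mkV_eqP => /=; split=> [a|b].
- have /elts_mkV[b ab] : elts (mkV (Sup G)) (mkV (F a)).
    by rewrite -e; apply/elts_mkV; exists a.
  by exists b; apply/mkV_eqP.
- have /elts_mkV[a ba] : elts (mkV (Sup F)) (mkV (G b)).
    by rewrite e; apply/elts_mkV; exists b.
  by exists a; apply/ens_eq_sym/mkV_eqP.
Qed.

Definition vzero : V := mkV (Sup (fun e : Empty_set => match e with end)).

Definition vone : V := mkV (Sup (fun _ : unit => repr vzero)).

Lemma elts_vzero : elts vzero = set0.
Proof. by apply/seteqP; split=> x // /elts_mkV[[]]. Qed.

Lemma elts_vone : elts vone = [set vzero].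
Proof.
apply/seteqP; split=> x /= => [/elts_mkV[_]|] ->; first by rewrite /mkV reprK.
by apply/elts_mkV; exists tt; rewrite /mkV reprK.
Qed.

Definition transitive_class (T : set V) : Prop :=
  forall x, T x -> elts x `<=` T.

Definition is_ordinal (a : V) : Prop :=
  [/\ transitive_class (elts a),
      forall x, elts a x -> ~ vmem x x,
      forall x y z, elts a x -> elts a y -> elts a z ->
        vmem x y -> vmem y z -> vmem x z
    & forall A : set V, A `<=` elts a -> A !=set0 ->
        exists2 m, A m & forall x, A x -> m = x \/ vmem m x].

Definition ord_le (a b : V) : Prop := vmem a b \/ a = b.

Definition is_cardinal (k : V) : Prop :=
  is_ordinal k /\ forall a, vmem a k -> elts a #!= elts k.

Definition is_cofinal (k : V) (A : set V) : Prop :=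
  A `<=` elts k /\ forall a, elts k a -> exists2 b, A b & ord_le a b.

(* k has cofinality k: for an infinite cardinal k, no cofinal subset of k has
   cardinality below k. *)
Definition is_regular_cardinal (k : V) : Prop :=
  [/\ is_cardinal k, infinite_set (elts k)
    & forall A, is_cofinal k A -> A #= elts k].

(* The functions from some a < k into k. *)
Definition fun_lt (k : V) : Type :=
  {a : elts k & (elts (val a) -> elts k)}.

(* The least transitive class including x. *)
Definition tcl (x : V) : set V :=
  [set y | forall T : set V, transitive_class T -> elts x `<=` T -> T y].

Definition H (k : V) : set V :=
  [set x | tcl x #<= elts k /\ tcl x #!= elts k].

Inductive formula : Type :=
| FEq (m n : nat)
| FIn (m n : nat)
| FS0 (m : nat)
| FS1 (m n : nat)
| FS2 (m n : nat)
| FS3 (m n : nat)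
| FNot (p : formula)
| FAnd (p q : formula)
| FEx (n : nat) (p : formula).

Fixpoint free_vars (p : formula) : seq nat :=
  match p with
  | FEq m n | FIn m n | FS1 m n | FS2 m n | FS3 m n => [:: m; n]
  | FS0 m => [:: m]
  | FNot p => free_vars p
  | FAnd p q => free_vars p ++ free_vars q
  | FEx n p => [seq m <- free_vars p | m != n]
  end.

Definition is_sentence (p : formula) : Prop := free_vars p = [::].

Record structure : Type := Structure {
  dom : Type;
  int_in : dom -> dom -> Prop;
  int_S0 : dom -> Prop;
  int_S1 : dom -> dom -> Prop;
  int_S2 : dom -> dom -> Prop;
  int_S3 : dom -> dom -> Prop }.

Definition assign (D : Type) (e : nat -> D) (n : nat) (d : D) : nat -> D :=
  fun m => if m == n then d else e m.

Fixpoint sat (M : structure) (p : formula) (e : nat -> dom M) : Prop :=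
  match p with
  | FEq m n => e m = e n
  | FIn m n => int_in (e m) (e n)
  | FS0 m => int_S0 (e m)
  | FS1 m n => int_S1 (e m) (e n)
  | FS2 m n => int_S2 (e m) (e n)
  | FS3 m n => int_S3 (e m) (e n)
  | FNot p => ~ sat p e
  | FAnd p q => sat p e /\ sat q e
  | FEx n p => exists d, sat p (assign e n d)
  end.

Definition models (M : structure) (p : formula) : Prop :=
  forall e : nat -> dom M, sat p e.

Definition pow2 (k : V) : Type := elts k -> bool.

(* f as a set of ordered pairs, with 2 = {0, 1}. *)
Definition graph (k : V) (f : pow2 k) (x y : V) : Prop :=
  exists a : elts k, x = val a /\ y = if f a then vone else vzero.

Definition Hstruct (k : V) (R : set (H k)) (f g h : pow2 k) : structure :=
  {| dom := H k;
     int_in := fun x y => vmem (val x) (val y);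
     int_S0 := R;
     int_S1 := fun x y => graph f (val x) (val y);
     int_S2 := fun x y => graph g (val x) (val y);
     int_S3 := fun x y => graph h (val x) (val y) |}.

Definition sim (k : V) (p : formula) (R : set (H k)) (f g : pow2 k) : Prop :=
  exists h, models (Hstruct R f g h) p.

Definition defines_Sigma11_equiv (k : V) (p : formula) (R : set (H k)) : Prop :=
  is_sentence p /\ Equivalence (sim p R).

Definition is_Sigma11_equiv (k : V) (E : pow2 k -> pow2 k -> Prop) : Prop :=
  exists (p : formula) (R : set (H k)),
    defines_Sigma11_equiv p R /\ E = sim p R.

Definition classes (T : Type) (E : T -> T -> Prop) : set (set T) :=
  [set C | exists f, C = [set g | E f g]].

Definition has_classes (T U : Type) (E : T -> T -> Prop) (X : set U) : Prop :=
  classes E #= X.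

(* Main.v *)
Require Import Defs.
From mathcomp Require Import all_boot.
From mathcomp Require Import boolp classical_sets functions cardinality.
From Stdlib Require Import RelationClasses Inverse_Image.

(** The difficulty is that the formulas [phi i] vary with [i], while truth in
H(kappa) is not definable over H(kappa), so that no first order formula can
speak of all of them at once. The existential quantifier over [h] and the
arbitrary parameter make up for this: the Sigma^1_1 relations turn out to be the
relations of the form [exists h, A f g h] with [A] a Borel set, where Borel sets
are built from basic open sets by complements and unions of size kappa.

One half of this equivalence is [analytic_sim]. From kappa^{<kappa} = kappa it
follows that H(kappa) has at most kappa elements ([H_small]), by coding a set
recursively by the set of codes of its elements. Hence a quantifier over H(kappa)
is a union of size kappa, and by induction on the formula satisfaction is a Borel
condition on (f, g, h).

The other half is [analytic_Sigma11]. A Borel set is evaluated by a well-founded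
circuit of NAND gates with at most kappa gates. A witness [h] can guess the
values of all gates at once, and since the circuit is well-founded the guess is
right as soon as each gate has the value prescribed by its inputs
([network_complete], [network_sound]). This is a condition on each gate separately,
so it is expressed by one sentence that does not depend on the circuit; the wiring
is stored in the parameter, as a set of ordered pairs ([sim_network]).

Formulas have now disappeared, and constructions with kappa many relations are
easy. For (ii), a point codes a family of points indexed by gamma, and two points
are equivalent when their components are, for every index; the witnesses of all the
components are coded by a single one ([analytic_prod]).

For (i), nothing is to be done if the supremum L is one of the cardinals chi_i.
Otherwise a point codes an index and another point, and two points are equivalent
when they have the same index [i] and their second parts are equivalent for the
i-th relation ([analytic_sum]). This gives as many classes as the sum of the
cardinals. When the index ranges over one representative of each value of [chi],
this sum is at least L, and at most the square of L since every value is a member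
of L. An infinite cardinal is equinumerous to its square ([square_step]), so there
are exactly L classes. *)

Set Implicit Arguments.
Unset Strict Implicit.
Unset Printing Implicit Defensive.

Local Open Scope classical_set_scope.
Local Open Scope card_scope.

(** * Cardinality through injections between types *)

Definition emb (T U : Type) : Prop := exists f : T -> U, injective f.

Lemma card_le_injP (T U : Type) (A : set T) (B : set U) : A #<= B <-> emb A B.
Proof.
split=> [/card_leP[f]|[f fI]].
  by exists f => x y; apply: inj; rewrite inE.
by apply/card_leP/injfunPex; exists f => // x y _ _; apply: fI.
Qed.

Lemma card_eq_bijP (T U : Type) (A : set T) (B : set U) :
  A #= B <-> exists f : A -> B, injective f /\ forall y, exists x, f x = y.
Proof.
split=> [/card_eqP[f]|[f [fI fS]]].
  exists f; split=> [x y|y]; first by apply: inj; rewrite inE.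
  by have [x _ <-] := @surj _ _ _ _ f y I; exists x.
apply/card_eqP/bijPex; exists f; split=> // [x y _ _|y _]; first exact: fI.
by have [x <-] := fS y; exists x.
Qed.

Definition elt (T : Type) (A : set T) (x : T) (Ax : A x) : A :=
  SigSub (mem_set Ax).

Lemma emb_trans T U W : emb T U -> emb U W -> emb T W.
Proof. by move=> [f fI] [g gI]; exists (g \o f) => x y /gI /fI. Qed.

Lemma emb_pair T U T' U' : emb T T' -> emb U U' -> emb (T * U) (T' * U').
Proof.
move=> [f fI] [g gI]; exists (fun p => (f p.1, g p.2)).
by move=> [x y] [x' y'] [/fI -> /gI ->].
Qed.

Lemma emb_subset (A B : set V) : A `<=` B -> emb A B.
Proof.
move=> AB; exists (fun x : A => elt (AB _ (set_valP x))) => x y.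
by move=> /(congr1 val) /= /val_inj.
Qed.

Lemma infinite_emb_nat (A : set V) : infinite_set A -> emb nat A.
Proof.
move=> /infiniteP /card_le_injP[f fI].
by exists (fun n => f (elt (I : [set: nat] n))) => m n /fI /(congr1 val).
Qed.

Lemma emb_card_eq (T U : Type) (A : set U) : emb T A -> emb A T -> [set: T] #= A.
Proof.
move=> [f fI] [g gI]; rewrite card_eq_le; apply/andP; split; apply/card_le_injP.
  by exists (fun x => f (val x)) => x y /fI /val_inj.
by exists (fun x => elt (I : setT (g x))) => x y /(congr1 val) /gI.
Qed.

(** * Membership, unordered and ordered pairs *)

Lemma vmem_ind (P : V -> Prop) :
  (forall x, (forall y, vmem y x -> P y) -> P x) -> forall x, P x.
Proof.
move=> IP x; have -> : x = mkV (repr x) by rewrite /mkV generic_quotient.reprK.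
elim: (repr x) => A F IF; apply: IP => y /elts_mkV[a ->]; exact: IF.
Qed.

Definition upair (x y : V) : V :=
  mkV (Sup (fun b : bool => repr (if b then x else y))).

Lemma elts_upair x y z : elts (upair x y) z <-> z = x \/ z = y.
Proof.
split=> [/elts_mkV[[]] ->|]; rewrite /mkV ?generic_quotient.reprK; auto.
by case=> ->; apply/elts_mkV; [exists true|exists false];
   rewrite /mkV generic_quotient.reprK.
Qed.

Lemma upairP x y z :
  z = upair x y <-> forall w, vmem w z <-> w = x \/ w = y.
Proof.
split=> [-> w|e]; first exact: elts_upair.
by apply: V_ext; apply/predeqP => w; rewrite elts_upair; apply: e.
Qed.

Definition opair (x y : V) : V := upair (upair x x) (upair x y).

Lemma upair_eq x y u v :
  upair x y = upair u v -> (x = u /\ y = v) \/ (x = v /\ y = u).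
Proof.
move=> e.
have : elts (upair u v) x by rewrite -e; apply/elts_upair; left.
have : elts (upair u v) y by rewrite -e; apply/elts_upair; right.
have : elts (upair x y) u by rewrite e; apply/elts_upair; left.
have : elts (upair x y) v by rewrite e; apply/elts_upair; right.
move=> /elts_upair ? /elts_upair ? /elts_upair ? /elts_upair ?.
by intuition congruence.
Qed.

Lemma opair_inj x y u v : opair x y = opair u v -> x = u /\ y = v.
Proof.
by move=> /upair_eq[][/upair_eq h1 /upair_eq h2]; intuition congruence.
Qed.

Lemma vone_upair : vone = upair vzero vzero.
Proof.
apply/upairP => w; have -> : vmem w vone = [set vzero] w by rewrite -elts_vone.
by split=> [->|[]]; [left| |].
Qed.

Lemma vmem0 x : ~ vmem x vzero.
Proof. by have -> : vmem x vzero = set0 x by rewrite -elts_vzero. Qed.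

Lemma vzeroP x : x = vzero <-> forall y, ~ vmem y x.
Proof.
split=> [-> y|h]; first exact: vmem0.
by apply: V_ext; apply/predeqP => y; split=> [/h|/vmem0].
Qed.

Lemma upair_neq0 x y : upair x y <> vzero.
Proof. by move=> /vzeroP /(_ x); apply; apply/elts_upair; left. Qed.

(** * Ordinals *)

Lemma ord_trans a x y : is_ordinal a -> vmem x a -> vmem y x -> vmem y a.
Proof. by case=> ta _ _ _ xa yx; apply: ta yx. Qed.

Lemma ord_elt_trans a x y z : is_ordinal a ->
  vmem x a -> vmem y x -> vmem z y -> vmem z x.
Proof.
move=> oa xa yx zy; have ya := ord_trans oa xa yx.
case: (oa) => _ _ tra _; exact: tra (ord_trans oa ya zy) ya xa zy yx.
Qed.

Lemma ord_elt a x : is_ordinal a -> vmem x a -> is_ordinal x.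
Proof.
move=> oa xa; case: (oa) => ta ia tra wa; split.
- by move=> y yx z zy; apply: (ord_elt_trans oa xa yx zy).
- by move=> y yx; apply: ia; apply: ord_trans oa xa yx.
- by move=> y z t yx zx tx; apply: tra; exact: ord_trans oa xa _.
- by move=> A Ax; apply: wa => y /Ax; apply: ord_trans.
Qed.

Lemma vmem_irr x : ~ vmem x x.
Proof. by elim/vmem_ind: x => x IH xx; apply: (IH x). Qed.

(** By a double induction: if no element of one is at least the other, then the two
have the same elements. *)
Lemma ord_total a b : is_ordinal a -> is_ordinal b ->
  [\/ vmem a b, a = b | vmem b a].
Proof.
elim/vmem_ind: a b => a IHa; elim/vmem_ind => b IHb oa ob.
have [[b' b'b h]|hb] := EM (exists2 b', vmem b' b & a = b' \/ vmem a b').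
  by apply: Or31; case: h => [->//|ab']; apply: ord_trans ob b'b ab'.
have [[a' a'a h]|ha] := EM (exists2 a', vmem a' a & b = a' \/ vmem b a').
  by apply: Or33; case: h => [->//|ba']; apply: ord_trans oa a'a ba'.
apply: Or32; apply: V_ext; apply/predeqP => x; split=> [xa|xb].
- by have [//|xb|bx] := IHa _ xa _ (ord_elt oa xa) ob;
    case: ha; exists x => //; [left|right].
- by have [ax|ax|//] := IHb _ xb oa (ord_elt ob xb);
    case: hb; exists x => //; [right|left].
Qed.

(** * Counting classes *)

(** [c] is a surjective complete invariant of [E]. *)
Definition classifies (T Y : Type) (E : T -> T -> Prop) (c : T -> Y) : Prop :=
  (forall f g, E f g <-> c f = c g) /\ forall y, exists f, c f = y.

Lemma classifies_equiv (T Y : Type) (E : T -> T -> Prop) (c : T -> Y) :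
  classifies E c -> Equivalence E.
Proof.
move=> [Ec _]; split=> [f|f g|f g h]; rewrite /= !Ec //.
by move=> ->.
Qed.

Lemma has_classes_classifies (T U : Type) (E : T -> T -> Prop) (X : set U) :
  Equivalence E -> has_classes E X -> exists c : T -> X, classifies E c.
Proof.
move=> [rE sE tE] /card_eq_bijP[b [bI bS]].
have cl f : classes E [set g | E f g] by exists f.
exists (fun f => b (elt (cl f))); split=> [f g|y].
  split=> [fg|/bI /(congr1 val) /= e]; last first.
    by change ([set h | E f h] g); rewrite e; apply: rE.
  congr b; apply: val_inj => /=; apply/predeqP => h.
  by split=> [|]; apply: tE => //; apply: sE.
have [C <-] := bS y; have [f Cf] := set_valP C; exists f.
by congr b; apply: val_inj; rewrite /= Cf.
Qed.

Lemma classifies_has_classes (T Y : Type) (E : T -> T -> Prop) (c : T -> Y) :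
  classifies E c -> has_classes E [set: Y].
Proof.
move=> [Ec cS]; apply/card_eq_bijP.
have rep (C : classes E) := cid (set_valP C).
have EcE (C : classes E) f : val C f <-> c (projT1 (rep C)) = c f.
  by rewrite -Ec; case: (rep C) => /= g ->.
exists (fun C => elt (I : setT (c (projT1 (rep C))))); split=> [C D|y].
  move=> /(congr1 val) /= e; apply: val_inj; apply/predeqP => f.
  by rewrite !EcE e.
have [f fy] := cS (val y); have Cf : classes E [set g | E f g] by exists f.
exists (elt Cf); apply: val_inj; rewrite /= -fy.
by apply/EcE => /=; apply/Ec.
Qed.

Section Kappa.
Variable kappa : V.
Hypothesis kappa_regular : is_regular_cardinal kappa.
Hypothesis kappa_uncountable : ~ countable (elts kappa).
Hypothesis kappa_pow : [set: fun_lt kappa] #= elts kappa.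

Local Notation K := (set_type (elts kappa)).

(** * Types with at most kappa elements *)

Definition small (T : Type) : Prop := emb T K.

Lemma small_inj (T U : Type) (f : T -> U) : injective f -> small U -> small T.
Proof. by move=> fI [g gI]; exists (g \o f) => x y /gI /fI. Qed.

Lemma kappa_ord : is_ordinal kappa.
Proof. by case: kappa_regular => -[]. Qed.

Lemma ltK_trans x y z : vmem z kappa -> vmem x y -> vmem y z -> vmem x z.
Proof. by move=> /(ord_elt kappa_ord) oz xy yz; apply: ord_trans oz yz xy. Qed.

Lemma K_max (a b : K) : exists c : K,
  forall x, vmem x (val a) \/ vmem x (val b) -> vmem x (val c).
Proof.
have [h|h|h] := ord_total (ord_elt kappa_ord (set_valP a))
                          (ord_elt kappa_ord (set_valP b)).
- exists b => x [xa|//]; exact: ltK_trans (set_valP b) xa h.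
- by exists b => x; rewrite h => -[].
- exists a => x [//|xb]; exact: ltK_trans (set_valP a) xb h.
Qed.

(** Together with [bounded_lt_card] this makes having fewer than kappa elements
an order property of a subset of kappa: it is being bounded. Unions of two such
subsets, and codes for them, then come without cardinal arithmetic. *)
Lemma lt_card_bounded (S : set V) : S `<=` elts kappa -> S #!= elts kappa ->
  exists a : K, S `<=` elts (val a).
Proof.
move=> Sk nS; apply: contrapT => nb; move/negP: nS; apply.
case: kappa_regular => _ _; apply; split=> // a ka.
apply: contrapT => h; apply: nb; exists (elt ka) => b Sb.
have [//|ba|ab] := ord_total (ord_elt kappa_ord (Sk _ Sb)) (ord_elt kappa_ord ka).
- by case: h; exists b => //; right; rewrite ba.
- by case: h; exists b => //; left.
Qed.

Lemma bounded_lt_card (S : set V) (a : K) : S `<=` elts (val a) ->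
  S #!= elts kappa.
Proof.
move=> Sa; apply/negP => Sk.
case: kappa_regular => -[_ /(_ _ (set_valP a)) /negP na] _ _; apply: na.
rewrite card_eq_le; apply/andP; split.
  by apply: subset_card_le => x; apply: ord_trans kappa_ord (set_valP a).
by have := subset_card_le Sa; rewrite (card_le_eql Sk).
Qed.

Lemma countable_bounded (S : set V) : S `<=` elts kappa -> countable S ->
  exists a : K, S `<=` elts (val a).
Proof.
move=> Sk cS; apply: lt_card_bounded => //; apply/negP => /eq_countable e.
by apply: kappa_uncountable; rewrite -e.
Qed.

Lemma K_succ (a : K) : exists b : K, vmem (val a) (val b).
Proof.
have [|b h] := @countable_bounded [set val a] _ (countable1 _).
  by move=> _ ->; apply: set_valP.
by exists b; apply: h.
Qed.

Lemma nat_small : small nat.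
Proof. by case: kappa_regular => _ /infinite_emb_nat. Qed.

Lemma fun_lt_small : small (fun_lt kappa).
Proof.
have /card_eq_bijP[f [fI _]] := kappa_pow.
exists (fun x => f (elt (I : setT x))) => x y /fI; exact: (congr1 val).
Qed.

(** Countable sequences count as functions on a bounded subset of kappa, because
a countable set is bounded in an uncountable regular cardinal. *)
Lemma seqK_small : small (nat -> K).
Proof.
have [s sI] := nat_small; pose S := range (val \o s).
have Sk : S `<=` elts kappa by move=> _ [n _ <-]; apply: set_valP.
have [|a Sa] := countable_bounded Sk.
  exact: card_le_trans (card_image_le _ _) (card_lexx _).
have sa n : elts (val a) (val (s n)) by apply: Sa; exists n.
have [k0] : inhabited K by constructor; apply: s 0.
pose rk (x : elts (val a)) : nat := xget 0 [set n | elt (sa n) = x].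
have rkK n : rk (elt (sa n)) = n.
  rewrite /rk; case: xgetP => [m _ /(congr1 val) e|/(_ n)[]//].
  by apply: sI; apply: val_inj.
pose F (u : nat -> K) : fun_lt kappa :=
  existT (fun b : K => elts (val b) -> K) a (fun x => u (rk x)).
pose G (p : fun_lt kappa) (n : nat) : K :=
  match pselect (elts (val (projT1 p)) (val (s n))) with
  | left h => projT2 p (elt h) | right _ => k0 end.
have FK u : G (F u) = u.
  apply/funext => m; rewrite /G /F /=; case: pselect => [h|/(_ (sa m))//].
  have -> : elt h = elt (sa m) by apply: val_inj.
  by rewrite rkK.
have [c cI] := fun_lt_small.
by exists (c \o F) => u v /cI e; rewrite -(FK u) e FK.
Qed.

Lemma K_small : small K. Proof. by exists id. Qed.

Lemma K_inhabited : inhabited K.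
Proof. by have [s _] := nat_small; constructor; exact: s 0. Qed.

Lemma pair_small (T U : Type) : small T -> small U -> small (T * U).
Proof.
move=> [f fI] [g gI].
apply: (@small_inj _ _ (fun p n => if n == 0 then f p.1 else g p.2) _ seqK_small).
move=> [x y] [x' y'] e.
have /fI /= -> := congr1 (@^~ 0) e.
by have /gI /= -> := congr1 (@^~ 1) e.
Qed.

Lemma bool_small : small bool.
Proof. by apply: (@small_inj _ _ nat_of_bool _ nat_small) => -[] []. Qed.

Lemma sum_small (T U : Type) : small T -> small U -> small (T + U).
Proof.
move=> sT sU; have [k0] := K_inhabited.
have [[f fI] [g gI]] := (sT, sU).
pose F (x : T + U) : bool * K :=
  match x with inl y => (true, f y) | inr y => (false, g y) end.
apply: (@small_inj _ _ F _ (pair_small bool_small K_small)).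
by move=> [x|x] [y|y] [] // => [/fI|/gI] ->.
Qed.

Lemma option_small (T : Type) : small T -> small (option T).
Proof.
move=> sT.
apply: (@small_inj _ _ (fun o => if o is Some x then inl x else inr true) _
  (sum_small sT bool_small)).
by move=> [x|] [y|] // [->].
Qed.

Lemma fun_nat_small (T : Type) : small T -> small (nat -> T).
Proof.
move=> [f fI]; apply: (@small_inj _ _ (fun u => f \o u) _ seqK_small).
by move=> u v e; apply/funext => n; apply: fI; exact: (congr1 (@^~ n) e).
Qed.

Lemma seq_small (T : Type) : small T -> small (seq T).
Proof.
move=> sT; apply: (@small_inj _ _ (fun s n => nth None (map Some s) n) _
  (fun_nat_small (option_small sT))).
have someI : injective (@Some T) by move=> ? ? [].
move=> s t e; apply: (inj_map someI).
have sz : size s = size t.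
  suff sub (a b : seq T) : nth None (map Some a) =1 nth None (map Some b) ->
      size a <= size b.
    by apply/eqP; rewrite eqn_leq !sub // => n; rewrite (congr1 (@^~ n) e).
  move=> h; rewrite leqNgt; apply/negP => lt.
  have := h (size b); rewrite [RHS]nth_default ?size_map //.
  by case: a lt {h} => // x a lt; rewrite (nth_map x).
by apply: (@eq_from_nth _ None); rewrite ?size_map // => n _;
  exact: (congr1 (@^~ n) e).
Qed.

(** * H(kappa) has at most kappa elements *)

(** A bounded subset of kappa is determined by a bound and by its indicator
function below that bound, and kappa^{<kappa} = kappa counts such functions. *)
Lemma bounded_code : exists c : set V -> K, forall S S' : set V,
  (exists a : K, S `<=` elts (val a)) -> (exists a : K, S' `<=` elts (val a)) ->
  c S = c S' -> S = S'.
Proof.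
have [s sI] := nat_small; have [c cI] := fun_lt_small.
pose D (p : fun_lt kappa) : set V :=
  [set x | exists y, val y = x /\ projT2 p y = s 1].
have /choice[C hC] : forall S : set V, exists p : fun_lt kappa,
    (exists a : K, S `<=` elts (val a)) -> D p = S.
  move=> S; have [[a Sa]|nS] := EM (exists a : K, S `<=` elts (val a)).
    pose F (y : elts (val a)) : K := if `[< S (val y) >] then s 1 else s 0.
    exists (existT (fun b : K => elts (val b) -> K) a F) => _.
    apply/predeqP => x; split=> [[y [<-]]|Sx] /=.
      by rewrite /F; case: asboolP => // _ /sI.
    by exists (elt (Sa _ Sx)); rewrite /F /=; split=> //; rewrite asboolT.
  exists (existT (fun b : K => elts (val b) -> K) (s 0) (fun _ => s 0)).
  by move=> /nS.
by exists (c \o C) => S S' hS hS' /cI e; rewrite -(hC S hS) -(hC S' hS') e.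
Qed.

Lemma lt_card_image_bounded (A : set V) (F : V -> K) :
  A #<= elts kappa -> A #!= elts kappa ->
  exists a : K, (fun x => val (F x)) @` A `<=` elts (val a).
Proof.
move=> Ak nA; apply: lt_card_bounded.
  by move=> _ [x _ <-]; apply: set_valP.
apply/negP => FA; move/negP: nA; apply.
rewrite card_eq_le Ak /= -(card_le_eql FA); exact: card_image_le.
Qed.

Lemma tcl_sub x y : vmem y x -> tcl y `<=` tcl x.
Proof.
move=> yx z zy T tT xT; apply: zy => // w wy.
by apply: tT wy; apply: xT.
Qed.

Lemma elts_tcl x : elts x `<=` tcl x.
Proof. by move=> y yx T _; apply. Qed.

Lemma sub_lt_card (A B : set V) : A `<=` B ->
  B #<= elts kappa /\ B #!= elts kappa -> A #<= elts kappa /\ A #!= elts kappa.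
Proof.
move=> AB [Bk nB]; split; first exact: card_le_trans (subset_card_le AB) Bk.
apply/negP => Ak; move/negP: nB; apply.
by rewrite card_eq_le Bk /= -(card_le_eql Ak) subset_card_le.
Qed.

Lemma H_trans : transitive_class (H kappa).
Proof. by move=> x Hx y /tcl_sub yx; apply: sub_lt_card yx Hx. Qed.

Lemma tcl_H x : H kappa x -> tcl x `<=` H kappa.
Proof. by move=> Hx y; apply; [exact: H_trans | exact: H_trans Hx]. Qed.

Lemma vmem_wf : well_founded vmem.
Proof. by move=> x; elim/vmem_ind: x => x IH; constructor => y /IH. Qed.

(** An element of H(kappa) is coded recursively by the code of the set of codes
of its elements, a set of fewer than kappa ordinals. *)
Lemma H_code : exists J : V -> K,
  forall x y, H kappa x -> H kappa y -> J x = J y -> x = y.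
Proof.
have [c cI] := bounded_code.
pose J : V -> K := Fix vmem_wf (fun _ => K) (fun x rec =>
  c [set z | exists y (h : vmem y x), z = val (rec y h)]).
have JE x : J x = c ((fun y => val (J y)) @` elts x).
  rewrite /J Fix_eq => [|y u v uv]; congr c; apply/predeqP => z /=.
    by split=> [[y [h ->]]|[y h <-]]; exists y => //; exists h.
  by split=> -[w [h ->]]; exists w, h; rewrite uv.
have bd x : H kappa x ->
    exists a : K, (fun y => val (J y)) @` elts x `<=` elts (val a).
  by move=> /(sub_lt_card (@elts_tcl x))[h1 h2]; apply: lt_card_image_bounded.
exists J => x; elim/vmem_ind: x => x IH y Hx Hy.
rewrite !JE => /cI e; have {}e := e (bd _ Hx) (bd _ Hy).
apply: V_ext; apply/predeqP => z; split=> zx.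
- have : ((fun y => val (J y)) @` elts y) (val (J z)) by rewrite -e; exists z.
  move=> [w wy] /val_inj Jw; rewrite (IH z zx w) //.
    exact: H_trans Hx _ zx.
  exact: H_trans Hy _ wy.
- have : ((fun y => val (J y)) @` elts x) (val (J z)) by rewrite e; exists z.
  move=> [w wx] /val_inj Jw; rewrite -(IH w wx z) //.
    exact: H_trans Hx _ wx.
  exact: H_trans Hy _ zx.
Qed.

Lemma H_small : small (H kappa).
Proof.
have [J JI] := H_code; exists (fun x => J (val x)) => x y /JI e.
by apply: val_inj; apply: e; apply: set_valP.
Qed.

Lemma kappa_sub_H : elts kappa `<=` H kappa.
Proof.
move=> x xk; apply: (@sub_lt_card _ (elts x)).
  move=> y; apply=> // z zx t tz; apply: ord_trans zx tz.
  exact: ord_elt kappa_ord xk.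
split; last exact: (@bounded_lt_card _ (elt xk)).
by apply: subset_card_le => y; apply: ord_trans kappa_ord xk.
Qed.

(** The transitive closure of a pair consists of the two sets and of the elements
of their closures; so the codes of its elements are bounded. *)
Lemma H_upair x y : H kappa x -> H kappa y -> H kappa (upair x y).
Proof.
move=> Hx Hy; have [J JI] := H_code.
pose A : set V := [set z | [\/ z = x, z = y, tcl x z | tcl y z]].
have AH : A `<=` H kappa by move=> z [->|->|/tcl_H|/tcl_H] //; apply.
have [a ha] := lt_card_image_bounded J Hx.1 Hx.2.
have [b hb] := lt_card_image_bounded J Hy.1 Hy.2.
have [[a' ha'] [b' hb']] := (K_succ (J x), K_succ (J y)).
have [[u hu] [v hv]] := (K_max a b, K_max a' b').
have [w hw] := K_max u v.
apply: (@sub_lt_card _ A).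
  move=> z; apply.
  - move=> t At r rt; case: At rt => [->|->|tx|ty] rt.
    + by apply: Or43; apply: elts_tcl.
    + by apply: Or44; apply: elts_tcl.
    + by apply: Or43 => T tT xT; apply: (tT t) rt; apply: tx.
    + by apply: Or44 => T tT xT; apply: (tT t) rt; apply: ty.
  - by move=> t /elts_upair[->|->]; [apply: Or41|apply: Or42].
have JA : {in A &, injective (val \o J)}.
  move=> t r; rewrite !inE => /AH tH /AH rH /val_inj; exact: JI.
have AJ := inj_card_eq JA.
have Jw : (val \o J) @` A `<=` elts (val w).
  move=> _ [z Az <-]; apply: hw; case: Az => [->|->|zx|zy].
  - by right; apply: hv; left.
  - by right; apply: hv; right.
  - by left; apply: hu; left; apply: ha; exists z.
  - by left; apply: hu; right; apply: hb; exists z.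
split; last by rewrite -(card_eql AJ); apply: bounded_lt_card Jw.
rewrite -(card_le_eql AJ); apply: subset_card_le => z /Jw.
exact: ord_trans kappa_ord (set_valP w).
Qed.

(** * Borel and analytic relations on the generalized Cantor space *)

Local Notation P2 := (pow2 kappa).

Inductive input : Type := InF of K | InG of K | InH of K.

Definition read (f g h : P2) (x : input) : bool :=
  match x with InF a => f a | InG a => g a | InH a => h a end.

(** Infinitary propositional formulas, with the NAND of a family of size kappa
as only connective; with respect to [read] they code the closure of the basic
open sets under complements and unions of size kappa. A leaf is negated so that
it too is a NAND, of a single input: every node of a circuit then obeys the same
rule, and one first order formula can state it for all of them. *)
Inductive circuit : Type := Leaf of input | Nand of (K -> circuit).

Fixpoint eval (v : input -> bool) (t : circuit) : Prop :=
  match t with Leaf x => ~ v x | Nand B => exists a, ~ eval v (B a) end.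

Definition borel (A : P2 -> P2 -> P2 -> Prop) : Prop :=
  exists t, forall f g h, eval (read f g h) t <-> A f g h.

Lemma borel_iff (A B : P2 -> P2 -> P2 -> Prop) :
  (forall f g h, A f g h <-> B f g h) -> borel A -> borel B.
Proof.
by move=> AB [t ht]; exists t => f g h; rewrite -AB; apply: ht.
Qed.

Lemma borel_not A : borel A -> borel (fun f g h => ~ A f g h).
Proof.
have [k0] := K_inhabited; move=> [t ht]; exists (Nand (fun _ => t)) => f g h /=.
by split=> [[a]|nA]; [rewrite ht|exists k0; rewrite ht].
Qed.

Lemma borel_leaf (x : input) : borel (fun f g h => read f g h x).
Proof.
apply: (@borel_iff (fun f g h => ~ ~ read f g h x)).
  by move=> f g h; split=> [/contrapT|? []].
by apply: borel_not; exists (Leaf x).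
Qed.

Lemma borel_F (a : K) : borel (fun f g h => f a).
Proof. exact: borel_leaf (InF a). Qed.

Lemma borel_G (a : K) : borel (fun f g h => g a).
Proof. exact: borel_leaf (InG a). Qed.

Lemma borel_H (a : K) : borel (fun f g h => h a).
Proof. exact: borel_leaf (InH a). Qed.

Lemma borel_exK (A : K -> P2 -> P2 -> P2 -> Prop) : (forall a, borel (A a)) ->
  borel (fun f g h => exists a, A a f g h).
Proof.
move=> bA; have /choice[t ht] := fun a => borel_not (bA a).
by exists (Nand t) => f g h /=; split=> -[a ha]; exists a;
  [apply: contrapT; rewrite -ht | rewrite ht].
Qed.

Lemma borel_const (P : Prop) : borel (fun f g h => P).
Proof.
have [s sI] := nat_small.
(* The family taking both values f (s 0) and ~ f (s 0) has a true member. *)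
pose T (f : P2) a : Prop := if `[< a = s 0 >] then f (s 0) : Prop else ~ f (s 0).
have bT : borel (fun f g h => exists a, T f a).
  apply: borel_exK => a; rewrite /T; case: asboolP => _; first exact: borel_F.
  exact: borel_not (borel_F _).
have tT f : exists a, T f a.
  have [f0|f0] := EM (f (s 0)); first by exists (s 0); rewrite /T asboolT.
  by exists (s 1); rewrite /T asboolF // => /sI.
have [p|np] := EM P; first by apply: borel_iff bT => f g h.
by apply: borel_iff (borel_not bT) => f g h; split=> // /(_ (tT f)).
Qed.

Lemma borel_ex (I : Type) (A : I -> P2 -> P2 -> P2 -> Prop) : small I ->
  (forall i, borel (A i)) -> borel (fun f g h => exists i, A i f g h).
Proof.
move=> [c cI] bA.
apply: (@borel_iff (fun f g h => exists a, exists i, c i = a /\ A i f g h)).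
  by move=> f g h; split=> [[_ [i [_ Ai]]]|[i Ai]]; [exists i|exists (c i), i].
apply: borel_exK => a; have [[i <-]|na] := EM (exists i, c i = a).
  apply: borel_iff (bA i) => f g h; split=> [Ai|[j [/cI -> //]]]; by exists i.
apply: borel_iff (borel_const False) => f g h; split=> // -[i [ci _]].
by apply: na; exists i.
Qed.

Lemma borel_all (I : Type) (A : I -> P2 -> P2 -> P2 -> Prop) : small I ->
  (forall i, borel (A i)) -> borel (fun f g h => forall i, A i f g h).
Proof.
move=> sI bA; apply: borel_iff (borel_not (borel_ex sI (fun i => borel_not (bA i)))).
by move=> f g h; rewrite -forallNE; split=> hA i; [apply: contrapT|move=> /(_ (hA i))].
Qed.

Lemma borel_or A B : borel A -> borel B -> borel (fun f g h => A f g h \/ B f g h).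
Proof.
move=> bA bB.
apply: borel_iff (borel_ex (A := fun b : bool => if b then A else B) bool_small _).
  by move=> f g h; split=> [[[]]|[]]; [left|right|exists true|exists false].
by case.
Qed.

Lemma borel_and A B : borel A -> borel B -> borel (fun f g h => A f g h /\ B f g h).
Proof.
move=> bA bB.
apply: borel_iff (borel_all (A := fun b : bool => if b then A else B) bool_small _).
  move=> f g h; split=> [hAB|[hA hB] []//].
    by split; [exact: (hAB true)|exact: (hAB false)].
by case.
Qed.

(** Preimages of Borel sets under Borel maps are Borel. *)
Lemma borel_subst (A : P2 -> P2 -> P2 -> Prop) (F G H : P2 -> P2 -> P2 -> P2) :
  (forall a, borel (fun f g h => F f g h a)) ->
  (forall a, borel (fun f g h => G f g h a)) ->
  (forall a, borel (fun f g h => H f g h a)) ->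
  borel A -> borel (fun f g h => A (F f g h) (G f g h) (H f g h)).
Proof.
move=> bF bG bH [t ht].
apply: (@borel_iff (fun f g h => eval (read (F f g h) (G f g h) (H f g h)) t)).
  by move=> f g h; apply: ht.
elim: t {ht} => [x|B IH] /=; last first.
  by apply: borel_exK => a; apply: borel_not; apply: IH.
by apply: borel_not; case: x.
Qed.

(** The existential quantifier over [h] in the definition of a Sigma^1_1 relation,
applied to a Borel rather than a first order matrix. *)
Definition analytic (E : P2 -> P2 -> Prop) : Prop :=
  exists2 A, borel A & forall f g, E f g <-> exists h, A f g h.

(** * First order definable relations are Borel *)

Lemma borel_graph (F : P2 -> P2 -> P2 -> P2) (x y : V) :
  (forall a, borel (fun f g h => F f g h a)) ->
  borel (fun f g h => graph (F f g h) x y).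
Proof.
move=> bF; apply: borel_exK => a; apply: borel_and; first exact: borel_const.
apply: (@borel_iff (fun f g h => F f g h a /\ y = vone \/ ~ F f g h a /\ y = vzero)).
  move=> f g h; case: (F f g h a).
    by split=> [[[]|[]//]|->] //; left.
  by split=> [[[]//|[_]]|->] //; right.
apply: borel_or; apply: borel_and; try exact: borel_const; first exact: bF.
by apply: borel_not; apply: bF.
Qed.

(** A first order quantifier over H(kappa) is a union of size kappa. *)
Lemma borel_sat (R : set (H kappa)) p (e : nat -> H kappa) :
  borel (fun f g h => @sat (Hstruct R f g h) p e).
Proof.
elim: p e => [m n|m n|m|m n|m n|m n|p IH|p IHp q IHq|n p IH] e /=;
  try exact: borel_const.
- by apply: borel_graph => a; apply: borel_F.
- by apply: borel_graph => a; apply: borel_G.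
- by apply: borel_graph => a; apply: borel_H.
- by apply: borel_not; apply: IH.
- by apply: borel_and; [apply: IHp|apply: IHq].
- by apply: borel_ex => [|d]; [exact: H_small|apply: IH].
Qed.

Lemma analytic_sim p (R : set (H kappa)) : analytic (sim p R).
Proof.
exists (fun f g h => models (Hstruct R f g h) p) => //.
exact: borel_iff (borel_all (fun_nat_small H_small) (borel_sat R p)).
Qed.

(** * NAND networks *)

(** A network prescribes, for each bit of [h], the inputs of which it is the
NAND. The prescription may be circular: this is what makes the bits
existentially quantified. *)
Definition solves (N : K -> set input) (f g h : P2) : Prop :=
  forall x, h x <-> exists2 l, N x l & ~ read f g h l.

(** A gate is named by its path from the root of the circuit. *)
Inductive node : Type := Root | Guess of bool & K | Gate of seq K.

Lemma node_small : small node.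
Proof.
pose c (n : node) : option ((bool * K) + seq K) :=
  match n with
  | Root => None | Guess b a => Some (inl (b, a)) | Gate p => Some (inr p) end.
apply: (@small_inj _ _ c); first by move=> [|? ?|?] [|? ?|?] //= [] => [-> ->|->].
apply: option_small; apply: sum_small; last exact: seq_small K_small.
exact: pair_small bool_small K_small.
Qed.

Fixpoint subcircuit (t : circuit) (p : seq K) {struct p} : option circuit :=
  match p, t with
  | [::], _ => Some t
  | a :: p, Nand B => subcircuit (B a) p
  | _, _ => None
  end.

Lemma subcircuit_rcons t p B a :
  subcircuit t p = Some (Nand B) -> subcircuit t (rcons p a) = Some (B a).
Proof. by elim: p t => [|b p IH] [x|C] //=; [case=> ->|move/IH]. Qed.

(** The two guesses for the bit [a] of [h] are each other's only input: one is the
negation of the other and nothing else is demanded of them. The root is an input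
of itself, hence cannot be false, hence its other input, the value of the whole
circuit, must be false. *)
Definition wires (c : node -> K) (t : circuit) (n : node) : set input :=
  match n with
  | Root => [set InH (c Root); InH (c (Gate [::]))]
  | Guess b a => [set InH (c (Guess (~~ b) a))]
  | Gate p =>
    match subcircuit t p with
    | Some (Leaf (InH a)) => [set InH (c (Guess true a))]
    | Some (Leaf l) => [set l]
    | Some (Nand B) => [set InH (c (Gate (rcons p a))) | a in setT]
    | None => set0
    end
  end.

Definition network (c : node -> K) (t : circuit) (x : K) : set input :=
  [set l | exists2 n, x = c n & wires c t n l].

(** The witness assigns to each gate the value of its subcircuit. *)
Lemma network_complete (c : node -> K) (t : circuit) (f g h : P2) :
  injective c -> ~ eval (read f g h) t -> exists h', solves (network c t) f g h'.
Proof.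
move=> cI nt.
pose v (n : node) : Prop :=
  match n with
  | Root => True
  | Guess b a => h a = b
  | Gate p => if subcircuit t p is Some u then eval (read f g h) u else False
  end.
pose h' (x : K) : bool := `[< exists2 n, x = c n & v n >].
have h'c n : h' (c n) <-> v n.
  split=> [/asboolP[m /cI ->] //|vn]; by apply/asboolP; exists n.
exists h' => x; split=> [/asboolP[n -> vn]|[l [n -> nl] nr]].
  suff [l nl rl] : exists2 l, wires c t n l & ~ read f g h' l.
    by exists l => //; exists n.
  case: n vn => [_|b a ab|p] /=.
  - exists (InH (c (Gate [::]))); [by right|by rewrite /= h'c].
  - exists (InH (c (Guess (~~ b) a))) => //=; rewrite h'c /= ab.
    by case: b {ab}.
  - case: (subcircuit t p) (@subcircuit_rcons t p) => // -[[a|a|a]|B] ps /= vn;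
      [by exists (InF a)|by exists (InG a)|exists (InH (c (Guess true a))) => //|].
      by rewrite /= h'c.
    have [a va] := vn; exists (InH (c (Gate (rcons p a)))); first by exists a.
    by rewrite /= h'c /= (ps _ a erefl).
apply/h'c; case: n nl nr => [|b a|p] //=.
- by move=> -> /=; rewrite h'c /=; case: (h a) b => -[].
- case: (subcircuit t p) (@subcircuit_rcons t p) => // -[[a|a|a]|B] ps;
    try by move=> ->.
    by move=> -> /=; rewrite h'c.
  by move=> [a _ <-] /=; rewrite h'c /= (ps _ a erefl) => nB; exists a.
Qed.

(** A circuit is well-founded, so the local rules leave no choice for the values of
its gates once the inputs and the guesses are given. *)
Lemma network_sound (c : node -> K) (t : circuit) (f g h' : P2) :
  injective c -> solves (network c t) f g h' ->
  ~ eval (read f g (fun a => h' (c (Guess true a)))) t.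
Proof.
move=> cI hh; set h := fun a => _.
have {}hh n : h' (c n) <-> exists2 l, wires c t n l & ~ read f g h' l.
  rewrite hh; split=> [[l [m /cI <- ml] rl]|[l nl rl]]; exists l => //.
  by exists n.
have gate p u : subcircuit t p = Some u ->
    (h' (c (Gate p)) <-> eval (read f g h) u).
  elim: u p => [x|B IH] p pu; rewrite hh /= pu.
    by case: x pu => a _ /=; split=> [[_ ->]|ra] //;
      [exists (InF a)|exists (InG a)|exists (InH (c (Guess true a)))].
  split=> [[_ [a _ <-]] /=|[a]].
    by rewrite (IH a _ (subcircuit_rcons a pu)); exists a.
  rewrite -(IH a _ (subcircuit_rcons a pu)) => na.
  by exists (InH (c (Gate (rcons p a)))); first exists a.
have root : h' (c Root).
  apply: contrapT => nr; apply: (nr); apply/hh.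
  by exists (InH (c Root)); first left.
have /hh[_ [->|->]] := root; first by [].
by move=> /= ne et; apply: ne; apply/(gate [::] t).
Qed.

(** * A sentence stating that a network has a solution *)

Definition FOr p q := FNot (FAnd (FNot p) (FNot q)).
Definition FIff p q := FAnd (FOr (FNot p) q) (FOr (FNot q) p).
Definition FAll n p := FNot (FEx n (FNot p)).

Definition FUpair z x y := FAll 9 (FIff (FIn 9 z) (FOr (FEq 9 x) (FEq 9 y))).

Definition FOpair z x y :=
  FEx 7 (FEx 8 (FAnd (FUpair 7 x x) (FAnd (FUpair 8 x y) (FUpair z 7 8)))).

Definition FWire t x y :=
  FEx 5 (FEx 6 (FAnd (FOpair 5 x y) (FAnd (FOpair 6 5 t) (FS0 6)))).

(** The variables 0, 1, 2 stand for the tags of the inputs from h, f, g, which are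
the sets 0, 1 = {0} and {1}; the first two of them are also the truth values. *)
Definition FSolves :=
  FAll 3 (FIff (FS3 3 1) (FEx 4
    (FOr (FAnd (FWire 0 3 4) (FS3 4 0))
    (FOr (FAnd (FWire 1 3 4) (FS1 4 0)) (FAnd (FWire 2 3 4) (FS2 4 0)))))).

Definition network_sentence :=
  FEx 0 (FEx 1 (FEx 2 (FAnd (FAll 9 (FNot (FIn 9 0)))
    (FAnd (FUpair 1 0 0) (FAnd (FUpair 2 1 1) FSolves))))).

Definition tag (l : input) : V :=
  match l with InF _ => vone | InG _ => upair vone vone | InH _ => vzero end.

Definition index (l : input) : K :=
  match l with InF a | InG a | InH a => a end.

Definition wire (x y t : V) : V := opair (opair x y) t.

Definition wire_set (N : K -> set input) : set (H kappa) :=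
  [set w | exists x l, N x l /\ val w = wire (val x) (val (index l)) (tag l)].

Lemma H_opair x y : H kappa x -> H kappa y -> H kappa (opair x y).
Proof. by move=> Hx Hy; apply: H_upair; apply: H_upair. Qed.

Section Satisfaction.
Variables (R : set (H kappa)) (f g h : P2).

Local Notation holds p e := (@sat (Hstruct R f g h) p e).

Lemma sat_and p q e : holds (FAnd p q) e <-> holds p e /\ holds q e.
Proof. by []. Qed.

Lemma sat_or p q e : holds (FOr p q) e <-> holds p e \/ holds q e.
Proof. by rewrite /= -not_orP notK. Qed.

Lemma sat_iff p q e : holds (FIff p q) e <-> (holds p e <-> holds q e).
Proof.
rewrite /FIff sat_and !sat_or /=.
by have [?|?] := EM (holds p e); have [?|?] := EM (holds q e); tauto.
Qed.

Lemma sat_all n p e :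
  holds (FAll n p) e <-> forall d : H kappa, holds p (assign e n d).
Proof.
rewrite /= -forallNE; split=> hp d; last by move=> /(_ (hp d)).
by apply: contrapT; apply: hp.
Qed.

Lemma sat_upair z x y e : [&& z != 9, x != 9 & y != 9] ->
  holds (FUpair z x y) e <-> val (e z) = upair (val (e x)) (val (e y)).
Proof.
case/and3P=> /negbTE z9 /negbTE x9 /negbTE y9; rewrite sat_all upairP.
have at9 (d : H kappa) : holds (FIff (FIn 9 z) (FOr (FEq 9 x) (FEq 9 y))) (assign e 9 d)
    <-> (vmem (val d) (val (e z)) <-> d = e x \/ d = e y).
  by rewrite sat_iff sat_or /= /assign /= z9 x9 y9.
split=> [he w|he d].
  split=> [wz|].
    have := (at9 (elt (H_trans (set_valP (e z)) wz))).1 (he _).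
    by move=> [/(_ wz)[e1|e1] _]; [left|right]; exact: (congr1 val e1).
  by case=> ->; apply/((at9 _).1 (he _)); [left|right].
apply/at9; rewrite (he (val d)).
by split=> -[]; [move/val_inj; left|move/val_inj; right|move=> ->; left|
  move=> ->; right].
Qed.

Lemma sat_opair z x y e : [&& z < 7, x < 7 & y < 7] ->
  holds (FOpair z x y) e <-> val (e z) = opair (val (e x)) (val (e y)).
Proof.
case/and3P=> z7 x7 y7.
have lt n k : n < 7 -> 6 < k -> n != k.
  by move=> nlt klt; apply: contraTneq nlt => ->; rewrite -leqNgt.
have asg n (d d' : dom (Hstruct R f g h)) : n < 7 -> assign (assign e 7 d) 8 d' n = e n.
  by move=> n7; rewrite /assign !(negbTE (lt _ _ _ _)).
have body (d d' : H kappa) :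
    holds (FAnd (FUpair 7 x x) (FAnd (FUpair 8 x y) (FUpair z 7 8)))
      (assign (assign e 7 d) 8 d') <->
    [/\ val d = upair (val (e x)) (val (e x)), val d' = upair (val (e x)) (val (e y))
      & val (e z) = upair (val d) (val d')].
  rewrite !sat_and !sat_upair ?(lt x) ?(lt y) ?(lt z) // ?(asg x) ?(asg y) ?(asg z) //.
  split=> [[h1 [h2 h3]]|[h1 h2 h3]]; last exact: (conj h1 (conj h2 h3)).
  exact: And3 h1 h2 h3.
split=> [[d [d' /body[dE d'E ->]]]|ze]; first by rewrite dE d'E.
exists (elt (H_upair (set_valP (e x)) (set_valP (e x)))).
by exists (elt (H_upair (set_valP (e x)) (set_valP (e y)))); apply/body.
Qed.

Lemma sat_wire t x y e : [&& t < 5, x < 5 & y < 5] ->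
  holds (FWire t x y) e <->
  exists2 w : H kappa, R w & val w = wire (val (e x)) (val (e y)) (val (e t)).
Proof.
case/and3P=> t5 x5 y5.
have lt n k : n < 5 -> 4 < k -> n != k.
  by move=> nlt klt; apply: contraTneq nlt => ->; rewrite -leqNgt.
have lt7 n : n < 5 -> n < 7 by move=> n5; apply: ltn_trans n5 _.
have asg n (d d' : dom (Hstruct R f g h)) : n < 5 -> assign (assign e 5 d) 6 d' n = e n.
  by move=> n7; rewrite /assign !(negbTE (lt _ _ _ _)).
have body (d d' : H kappa) :
    holds (FAnd (FOpair 5 x y) (FAnd (FOpair 6 5 t) (FS0 6)))
      (assign (assign e 5 d) 6 d') <->
    [/\ val d = opair (val (e x)) (val (e y)),
        val d' = opair (val d) (val (e t)) & R d'].
  rewrite !sat_and !sat_opair ?(lt7 x) ?(lt7 y) ?(lt7 t) //.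
  rewrite ?(asg x) ?(asg y) ?(asg t) //.
  split=> [[h1 [h2 h3]]|[h1 h2 h3]]; last exact: (conj h1 (conj h2 h3)).
  exact: And3 h1 h2 h3.
split=> [[d [d' /body[dE d'E Rd']]]|[w Rw wE]].
  by exists d' => //; rewrite d'E dE.
exists (elt (H_opair (set_valP (e x)) (set_valP (e y)))), w.
by apply/body.
Qed.

End Satisfaction.

Lemma H_vzero : H kappa vzero.
Proof.
have [k0] := K_inhabited.
apply: sub_lt_card (kappa_sub_H (set_valP k0)) => y.
by move/(_ set0) => h; case: h => // x /vmem0.
Qed.

Lemma graphP (F : P2) (x : K) b :
  graph F (val x) (if b then vone else vzero) <-> F x = b.
Proof.
have v01 : vone <> vzero by rewrite vone_upair; apply: upair_neq0.
split=> [[y [/val_inj <-]]|<-]; last by exists x.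
by case: b (F x) => -[] // e; case: v01.
Qed.

Lemma graph_dom (F : P2) (a b : V) : graph F a b -> exists x : K, a = val x.
Proof. by move=> [x [-> _]]; exists x. Qed.

Lemma tag_inj l l' : tag l = tag l' -> index l = index l' -> l = l'.
Proof.
have v01 : vone <> vzero by rewrite vone_upair; apply: upair_neq0.
have v12 : vone <> upair vone vone.
  by rewrite {1}vone_upair => /upair_eq[][] /esym /v01.
have v02 : upair vone vone <> vzero by apply: upair_neq0.
by case: l l' => [a|a|a] [b|b|b] /= e; do ?[by move=> ->];
  exfalso; do [exact: v01 e|exact: v02 e|exact: v12 e|exact: v01 (esym e)
    |exact: v02 (esym e)|exact: v12 (esym e)].
Qed.

(** The parameter determines the wires because ordered pairs are injective, and
H(kappa) contains all the sets involved because it is closed under pairs. *)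
Lemma sat_solves N (f g h : P2) e :
  val (e 0) = vzero -> val (e 1) = vone -> val (e 2) = upair vone vone ->
  @sat (Hstruct (wire_set N) f g h) FSolves e <-> solves N f g h.
Proof.
move=> e0 e1 e2.
(* What the formula says about inputs of one kind: [F] is the point read, and
[mk] builds the input. *)
have wires (t : V) (F : P2) (mk : K -> input) (a b : V) :
    (forall y, tag (mk y) = t) -> (forall y, index (mk y) = y) ->
    (exists2 w : H kappa, wire_set N w & val w = wire a b t) /\ graph F b vzero <->
    exists x y : K, [/\ a = val x, b = val y, N x (mk y) & ~ F y].
  move=> tagE indexE; split=> [[[w [x [l [Nl ->]]]]]|[x [y [-> -> Nxy Fy]]]].
    move=> /opair_inj[/opair_inj[<- <-] te] /(graphP F (index l) false) Fl.
    exists x, (index l); rewrite Fl; split=> //.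
    by rewrite -(_ : l = mk (index l)) //; apply: tag_inj; rewrite ?tagE ?indexE.
  split; last by apply/(graphP F y false)/negbTE/negP.
  have Ht : H kappa (tag (mk y)).
    have H1 : H kappa vone by rewrite vone_upair; apply: H_upair H_vzero H_vzero.
    by case: (mk y) => ? //=; [apply: H_upair|apply: H_vzero].
  have HK z : H kappa (val (z : K)) by apply: kappa_sub_H; apply: set_valP.
  exists (elt (H_opair (H_opair (HK x) (HK y)) Ht)); last by rewrite -(tagE y).
  by exists x, (mk y); rewrite indexE.
have matrix (d d' : H kappa) :
    @sat (Hstruct (wire_set N) f g h) (FOr (FAnd (FWire 0 3 4) (FS3 4 0))
      (FOr (FAnd (FWire 1 3 4) (FS1 4 0)) (FAnd (FWire 2 3 4) (FS2 4 0))))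
      (assign (assign e 3 d) 4 d') <->
    exists x l, [/\ val d = val x, val d' = val (index l), N x l & ~ read f g h l].
  rewrite !sat_or !sat_and !sat_wire //.
  rewrite /= /assign /= e0 e1 e2.
  rewrite (wires _ _ InH) // (wires _ _ InF) // (wires _ _ InG) //.
  split=> [[|[]] [x [y hxy]]|[x [l hxl]]].
  - by exists x, (InH y).
  - by exists x, (InF y).
  - by exists x, (InG y).
  by case: l hxl => y hxy; [right; left|right; right|left]; exists x, y.
have at3 (d : H kappa) : @sat (Hstruct (wire_set N) f g h) (FIff (FS3 3 1) (FEx 4
      (FOr (FAnd (FWire 0 3 4) (FS3 4 0))
      (FOr (FAnd (FWire 1 3 4) (FS1 4 0)) (FAnd (FWire 2 3 4) (FS2 4 0))))))
      (assign e 3 d) <->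
    (graph h (val d) vone <->
     exists x l, [/\ val d = val x, N x l & ~ read f g h l]).
  have iff_congr (A A' B B' : Prop) :
    (A <-> A') -> (B <-> B') -> ((A <-> B) <-> (A' <-> B')) by tauto.
  rewrite sat_iff; apply: iff_congr.
    by rewrite /= /assign /= e1.
  split=> [[d' /matrix[x [l [dx _ Nl rl]]]]|[x [l [dx Nl rl]]]].
    by exists x, l.
  exists (elt (kappa_sub_H (set_valP (index l)))); apply/matrix.
  by exists x, l.
rewrite sat_all; split=> [hall x|hs d].
  have := (at3 (elt (kappa_sub_H (set_valP x)))).1 (hall _).
  rewrite (graphP h x true) /is_true => ->.
  split=> [[y [l [xy Nl rl]]]|[l]]; last by exists x, l.
  by exists l => //; rewrite (_ : x = y) //; apply: val_inj.
apply/at3; split=> [hd|[x [l [-> Nl rl]]]].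
  have [x dx] := graph_dom hd; move: hd; rewrite dx => /(graphP h x true)/hs[l].
  by exists x, l.
by apply/(graphP h x true)/hs; exists l.
Qed.

Lemma sim_network N f g :
  sim network_sentence (wire_set N) f g <-> exists h, solves N f g h.
Proof.
have [h0 h1] : H kappa vzero /\ H kappa vone.
  by rewrite vone_upair; split; [|apply: H_upair]; apply: H_vzero.
have h2 : H kappa (upair vone vone) by apply: H_upair.
suff body h e : @sat (Hstruct (wire_set N) f g h) network_sentence e <-> solves N f g h.
  split=> -[h hh]; exists h; last by move=> e; apply/body.
  by apply/(body h (fun _ => elt h0)).
have matrix (d0 d1 d2 : H kappa) :
    @sat (Hstruct (wire_set N) f g h) (FAnd (FAll 9 (FNot (FIn 9 0)))
      (FAnd (FUpair 1 0 0) (FAnd (FUpair 2 1 1) FSolves)))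
      (assign (assign (assign e 0 d0) 1 d1) 2 d2) <->
    [/\ val d0 = vzero, val d1 = vone, val d2 = upair vone vone & solves N f g h].
  rewrite !sat_and sat_all !sat_upair //; split.
    move=> [d00 [d10 [d21 hs]]].
    have d0E : val d0 = vzero.
      by apply/vzeroP => y yd; apply: (d00 (elt (H_trans (set_valP d0) yd))).
    have d1E : val d1 = vone by rewrite vone_upair -d0E; exact: d10.
    have d2E : val d2 = upair vone vone by rewrite -d1E; exact: d21.
    by split=> //; rewrite sat_solves in hs.
  move=> [d0E d1E d2E hs]; split.
    by move=> d /=; rewrite /assign /= d0E; apply: vmem0.
  split; first by change (val d1 = upair (val d0) (val d0)); rewrite d1E d0E vone_upair.
  split; first by change (val d2 = upair (val d1) (val d1)); rewrite d2E d1E.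
  by rewrite sat_solves.
split=> [[d0 [d1 [d2 /matrix[]]]] //|hs].
by exists (elt h0), (elt h1), (elt h2); apply/matrix.
Qed.

(** The network is built for the complement of the Borel matrix, since its solutions
are the ways to make the circuit false. *)
Lemma analytic_Sigma11 (E : P2 -> P2 -> Prop) :
  analytic E -> Equivalence E -> is_Sigma11_equiv E.
Proof.
move=> [A bA EA] eqE; have [t ht] := borel_not bA; have [c cI] := node_small.
have ES : E = sim network_sentence (wire_set (network c t)).
  apply/funext => f; apply/funext => g; apply/propext; rewrite EA sim_network.
  split=> [[h hA]|[h hs]].
    by apply: network_complete cI _; rewrite ht => /(_ hA).
  by eexists; apply: contrapT; rewrite -ht; apply: network_sound cI hs.
exists network_sentence, (wire_set (network c t)); split=> //; split=> //.
by rewrite -ES.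
Qed.

(** * Products and sums of analytic equivalence relations *)

(** A point codes a family of points through an injection of [I * K] into kappa;
every family of witnesses is coded by a single one. *)
Lemma analytic_prod (I : Type) (Y : I -> Type) (E : I -> P2 -> P2 -> Prop)
    (c : forall i, P2 -> Y i) :
  small I -> (forall i, analytic (E i)) -> (forall i, classifies (E i) (c i)) ->
  exists E' : P2 -> P2 -> Prop, analytic E' /\
    exists c' : P2 -> forall i, Y i, classifies E' c'.
Proof.
move=> sI aE cE; have [p pI] := pair_small sI K_small.
pose part (f : P2) i : P2 := fun a => f (p (i, a)).
have merge (u : I -> P2) : exists f, forall i, part f i = u i.
  exists (fun x => `[< exists i a, p (i, a) = x /\ u i a >]) => i.
  apply/funext => a; rewrite /part; apply/asboolP/idP => [[j [b [/pI[-> ->]]]]|ua] //.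
  by exists i, a.
have /choice[A hA] : forall i, exists A, borel A /\
    forall f g, E i f g <-> exists h, A f g h.
  by move=> i; have [A bA EA] := aE i; exists A.
exists (fun f g => forall i, E i (part f i) (part g i)); split.
  exists (fun f g h => forall i, A i (part f i) (part g i) (part h i)).
    apply: (borel_all sI) => i.
    by apply: borel_subst (hA i).1 => a;
      [exact: borel_F|exact: borel_G|exact: borel_H].
  move=> f g; split=> [hE|[h hh] i]; last by apply/(hA i).2; exists (part h i).
  have /choice[u hu] i := ((hA i).2 _ _).1 (hE i).
  by have [h hh] := merge u; exists h => i; rewrite hh.
exists (fun f i => c i (part f i)); split=> [f g|y].
  split=> [hE|hc i]; last by apply/(cE i).1; rewrite [LHS](congr1 (@^~ i) hc).
  by apply: functional_extensionality_dep => i; apply/(cE i).1.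
have /choice[u hu] i := (cE i).2 (y i).
have [f hf] := merge u; exists f.
by apply: functional_extensionality_dep => i; rewrite hf.
Qed.

(** A sum needs a Borel partition of the space into pieces indexed by [I]. A choice
of one of the marked indices would not be Borel; only a mark that is alone is
heeded, and all other points go to the piece of the default index. *)
Definition marks (I : Type) (s : I -> K) (f : P2) (i : I) : Prop :=
  f (s i) /\ forall j, j = i \/ ~ f (s j).

Definition has_index (I : Type) (s : I -> K) (i0 : I) (f : P2) (i : I) : Prop :=
  marks s f i \/ i = i0 /\ ~ exists j, marks s f j.

Lemma index_exists (I : Type) (s : I -> K) (i0 : I) (f : P2) :
  exists i, forall j, has_index s i0 f j <-> i = j.
Proof.
have [[i mi]|nm] := EM (exists i, marks s f i).
  exists i => j; split=> [[mj|[_ []]]|<-]; [|by exists i|by left].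
  by have [//|[]] := mj.2 i; exact: mi.1.
exists i0 => j; split=> [[mj|[//]]|<-]; last by right.
by case: nm; exists j.
Qed.

Lemma borel_has_index (I : Type) (s : I -> K) (i0 i : I) (F : P2 -> P2 -> P2 -> P2) :
  small I -> (forall a, borel (fun f g h => F f g h a)) ->
  borel (fun f g h => has_index s i0 (F f g h) i).
Proof.
move=> sI bF.
have bm j : borel (fun f g h => marks s (F f g h) j).
  apply: borel_and; first exact: bF.
  apply: (borel_all sI) => k; apply: borel_or; first exact: borel_const.
  by apply: borel_not; apply: bF.
apply: borel_or; first exact: bm.
by apply: borel_and; [exact: borel_const|exact: borel_not (borel_ex sI bm)].
Qed.

(** The bits that carry the index are disjoint from those that carry the point to
be classified, so each piece of the partition contains a copy of the space. *)
Lemma analytic_sum (I : Type) (Y : I -> Type) (E : I -> P2 -> P2 -> Prop)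
    (c : forall i, P2 -> Y i) (i0 : I) :
  small I -> (forall i, analytic (E i)) -> (forall i, classifies (E i) (c i)) ->
  exists E' : P2 -> P2 -> Prop, analytic E' /\
    exists c' : P2 -> {i : I & Y i}, classifies E' c'.
Proof.
move=> sI aE cE; have [s sInj] := sum_small sI K_small.
pose tail (f : P2) : P2 := fun a => f (s (inr a)).
pose ix := has_index (s \o inl) i0.
have [idx hidx] := choice (index_exists (s \o inl) i0).
have ixx f : ix f (idx f) by apply/hidx.
have /choice[A hA] : forall i, exists A, borel A /\
    forall f g, E i f g <-> exists h, A f g h.
  by move=> i; have [A bA EA] := aE i; exists A.
exists (fun f g => exists i, [/\ ix f i, ix g i & E i (tail f) (tail g)]); split.
  exists (fun f g h => exists i, ix f i /\ ix g i /\ A i (tail f) (tail g) h).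
    apply: (borel_ex sI) => i; apply: borel_and.
      by apply: (@borel_has_index _ _ _ _ (fun f _ _ => f) sI) => a; apply: borel_F.
    apply: borel_and; first by
      apply: (@borel_has_index _ _ _ _ (fun _ g _ => g) sI) => a; apply: borel_G.
    by apply: borel_subst (hA i).1 => a;
      [exact: borel_F|exact: borel_G|exact: borel_H].
  move=> f g; split=> [[i [fi gi /(hA i).2[h hh]]]|[h [i [fi [gi hh]]]]].
    by exists h, i.
  by exists i; split=> //; apply/(hA i).2; exists h.
pose c' f := existT Y (idx f) (c (idx f) (tail f)).
have c'E f i : ix f i -> c' f = existT Y i (c i (tail f)) by move=> /hidx <-.
exists c'; split=> [f g|[i y]].
  split=> [[i [fi gi /(cE i).1 e]]|e]; first by rewrite (c'E f i) // (c'E g i) // e.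
  pose Q (z : {i & Y i}) := ix f (projT1 z) /\ c (projT1 z) (tail f) = projT2 z.
  have : Q (c' f) by split.
  by rewrite e => -[/= fg /(cE _).1 Eg]; exists (idx g).
have [f0 f0y] := (cE i).2 y.
pose f x := `[< x = s (inl i) \/ exists a, x = s (inr a) /\ f0 a >].
have ff : tail f = f0.
  apply/funext => a; apply/asboolP/idP => [[/sInj //|[b [/sInj[->]]]]|fa] //.
  by right; exists a.
exists f; rewrite (c'E f i) ?ff ?f0y //; left; split.
  by apply/asboolP; left.
move=> j; have [->|ji] := EM (j = i); [by left|right].
by move=> /asboolP[/sInj[]|[a [/sInj]]].
Qed.

End Kappa.

(** * Squares of infinite ordinals *)

Section Greedy.
Variables (T U : Type) (lt : T -> T -> Prop).
Hypothesis lt_wf : well_founded lt.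
Hypothesis lt_total : forall p q, [\/ lt p q, p = q | lt q p].
Hypothesis fresh : forall p (G : forall q, lt q p -> U),
  exists u, forall q h, G q h <> u.

(** Sending each [p] to a value not taken before is injective, because any two
arguments are comparable. *)
Lemma greedy_injection : exists f : T -> U, injective f.
Proof.
pose next p (G : forall q, lt q p -> U) : U := projT1 (cid (fresh G)).
pose f : T -> U := Fix lt_wf (fun _ => U) next.
have fE p : f p = next p (fun q _ => f q).
  rewrite /f Fix_eq // => q G G' GG; congr next.
  apply: functional_extensionality_dep => r.
  by apply: functional_extensionality_dep => h; apply: GG.
have fN p q : lt q p -> f q <> f p.
  by move=> qp; rewrite [f p]fE /next; case: cid => /= u; apply.
exists f => p q e; have [pq|//|qp] := lt_total p q.
  by case: (fN _ _ pq).
by case: (fN _ _ qp).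
Qed.

End Greedy.

Definition omax (p : V * V) : V := if `[< vmem p.1 p.2 >] then p.2 else p.1.

(** Goedel's well-ordering of pairs of ordinals. *)
Definition pair_lt (q p : V * V) : Prop :=
  vmem (omax q) (omax p) \/
  omax q = omax p /\ (vmem q.1 p.1 \/ q.1 = p.1 /\ vmem q.2 p.2).

Lemma pair_lt_wf : well_founded pair_lt.
Proof.
suff acc m x y p : omax p = m -> p.1 = x -> p.2 = y -> Acc pair_lt p.
  by move=> p; apply: acc.
elim/vmem_ind: m x y p => m IHm; elim/vmem_ind => x IHx; elim/vmem_ind => y IHy p.
move=> pm px py; constructor => q [qp|[qp [qx|[qx qy]]]].
- by apply: IHm; rewrite -?pm //; exact: qp.
- by apply: IHx; rewrite ?qp -?px //; exact: qx.
- by apply: IHy; rewrite ?qp ?qx -?py //; exact: qy.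
Qed.

Lemma omax_le p : is_ordinal p.1 -> is_ordinal p.2 ->
  ord_le p.1 (omax p) /\ ord_le p.2 (omax p).
Proof.
move=> o1 o2; rewrite /omax /ord_le; case: asboolP => h; first by split; [left|right].
by split; [right|have [//|->|] := ord_total o1 o2; [right|left]].
Qed.

Lemma omax_ind (P : V -> Prop) p : P p.1 -> P p.2 -> P (omax p).
Proof. by rewrite /omax; case: asboolP. Qed.

Lemma pair_lt_total p q : is_ordinal p.1 -> is_ordinal p.2 ->
  is_ordinal q.1 -> is_ordinal q.2 -> [\/ pair_lt p q, p = q | pair_lt q p].
Proof.
move=> p1 p2 q1 q2; rewrite /pair_lt.
have [m|m|m] := ord_total (omax_ind p1 p2) (omax_ind q1 q2);
  [by apply: Or31; left| |by apply: Or33; left].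
have [h1|h1|h1] := ord_total p1 q1;
  [by apply: Or31; right; split=> //; left| |by apply: Or33; right; split=> //; left].
have [h2|h2|h2] := ord_total p2 q2.
- by apply: Or31; right; split=> //; right.
- by apply: Or32; case: p q h1 h2 {p1 p2 q1 q2 m} => ? ? [? ?] /= -> ->.
- by apply: Or33; right; split=> //; right.
Qed.

(** Adding a point to [A] is harmless because [A] embeds in its square as the
diagonal, which leaves room for one more point. *)
Lemma emb_adjoin_square (A S : set V) (a : V) : infinite_set A ->
  emb (A * A) A -> S `<=` A `|` [set a] -> emb (S * S) A.
Proof.
move=> /infinite_emb_nat[s sI] AA SA.
suff SAA : emb S (A * A).
  exact: emb_trans (emb_trans (emb_pair SAA SAA) (emb_pair AA AA)) AA.
pose d (x : S) : A * A :=
  match pselect (A (val x)) with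
  | left h => (elt h, elt h) | right _ => (s 0, s 1) end.
exists d => x y; rewrite /d.
have out (z : S) : ~ A (val z) -> val z = a.
  by move=> nA; have [|] := SA _ (set_valP z).
case: pselect => hx; case: pselect => hy.
- by move=> [/= e _]; apply: val_inj; exact: e.
- by move=> [-> /sI].
- by move=> [<- /sI].
- by move=> _; apply: val_inj; rewrite (out x hx) (out y hy).
Qed.

(** Unless [L] has the size of one of its elements, which is then covered by the
hypothesis on elements, its square is injected greedily into [L] along Goedel's
well-ordering: an initial segment lies in the square of the successor of an
element of [L], hence is too small to exhaust [L]. *)
Lemma square_step (L : set V) : (forall x, L x -> is_ordinal x) ->
  transitive_class L -> infinite_set L ->
  (forall x, L x -> infinite_set (elts x) -> emb (elts x * elts x) (elts x)) ->
  emb (L * L) L.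
Proof.
move=> oL tL iL IH.
have [[b Lb Leb]|small] := EM (exists2 b, L b & emb L (elts b)).
  have ib : infinite_set (elts b).
    move=> fb; apply: iL; apply: card_le_finite fb.
    exact/card_le_injP.
  exact: emb_trans (emb_trans (emb_pair Leb Leb) (IH b Lb ib)) (emb_subset (tL _ Lb)).
pose vv (p : L * L) : V * V := (val p.1, val p.2).
apply: (@greedy_injection _ _ (fun q p => pair_lt (vv q) (vv p))).
- exact: (wf_inverse_image _ _ _ vv pair_lt_wf).
- move=> p q; have oo (x : L) : is_ordinal (val x) by apply: oL; apply: set_valP.
  have [h|[e1 e2]|h] := @pair_lt_total (vv p) (vv q) (oo _) (oo _) (oo _) (oo _);
    [exact: Or31| |exact: Or33].
  by apply: Or32; case: p q e1 e2 => ? ? [? ?] /= /val_inj -> /val_inj ->.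
move=> p G; apply: contrapT => nfresh.
have /choice[i hi] u : exists q, exists h, G q h = u.
  apply: contrapT => nq; apply: nfresh; exists u => q h e.
  by apply: nq; exists q, h.
pose a := omax (vv p).
have La : L a by apply: omax_ind; apply: set_valP.
pose S : set V := elts a `|` [set a].
have le_trans x y : ord_le x y -> ord_le y a -> S x.
  rewrite /ord_le => -[xy|->] [ya|ya]; [left|left|left|right] => //.
  - exact: ord_trans (oL _ La) ya xy.
  - by rewrite -ya.
have iS u : S (val (i u).1) /\ S (val (i u).2).
  have [h _] := hi u.
  have ma : ord_le (omax (vv (i u))) a by case: h => [|[]]; [left|right].
  have [m1 m2] := @omax_le (vv (i u)) (oL _ (set_valP _)) (oL _ (set_valP _)).
  by split; apply: le_trans ma.
have LS : emb L (S * S).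
  exists (fun u => (elt (iS u).1, elt (iS u).2)) => u w [/val_inj e1 /val_inj e2].
  have e : i u = i w by case: (i u) (i w) e1 e2 => ? ? [? ?] /= -> ->.
  have [[h <-] [h' <-]] := (hi u, hi w).
  by move: h h'; rewrite e => h h'; congr G; apply: Prop_irrelevance.
have [fa|ia] := EM (finite_set (elts a)); last first.
  apply: small; exists a => //; apply: emb_trans LS _.
  exact: emb_adjoin_square ia (IH a La ia) (fun x => id).
have fS : finite_set S by rewrite finite_setU; split=> //; apply: finite_set1.
apply: iL; apply: card_le_finite (finite_setX fS fS); apply/card_le_injP.
apply: emb_trans LS _.
have SS (q : S * S) : (S `*` S) (val q.1, val q.2) by split; apply: set_valP.
exists (fun q => elt (SS q)).
by move=> [? ?] [? ?] /(congr1 val) /= [/val_inj -> /val_inj ->].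
Qed.

Lemma ordinal_square a : is_ordinal a -> infinite_set (elts a) ->
  emb (elts a * elts a) (elts a).
Proof.
elim/vmem_ind: a => a IH oa ia; apply: square_step => // [x|x|x xa].
- exact: ord_elt.
- by move=> xa y; apply: ord_trans oa xa.
- by apply: (IH x xa); apply: ord_elt oa xa.
Qed.

(** * The supremum of a family of cardinals *)

Section Supremum.
Variables (I : Type) (i0 : I) (chi : I -> V).
Hypothesis chi_ord : forall i, is_ordinal (chi i).

Let L : set V := \bigcup_(i in [set: I]) elts (chi i).

Lemma sup_not_attained : (forall i, L <> elts (chi i)) ->
  forall i, exists j, vmem (chi i) (chi j).
Proof.
move=> nL i; apply: contrapT => nj; apply: (nL i).
apply/predeqP => x; split=> [[j _ xj]|xi]; last by exists i.
have [ij|->//|ji] := ord_total (chi_ord i) (chi_ord j).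
  by case: nj; exists j.
exact: ord_trans (chi_ord i) ji xj.
Qed.

Hypothesis unbounded : forall i, exists j, vmem (chi i) (chi j).

(** Iterating the step to a larger value gives an increasing sequence in [L]. *)
Lemma sup_infinite : infinite_set L.
Proof.
have [g hg] := choice unbounded.
pose s n := chi (iter n g i0).
have s_lt m n : m < n -> vmem (s m) (s n).
  elim: n => // n IH; rewrite ltnS leq_eqVlt => /predU1P[->|/IH mn].
    exact: hg.
  exact: ord_trans (chi_ord _) (hg _) mn.
have sL n : L (s n) by exists (iter n.+1 g i0) => //; apply: hg.
apply/infiniteP/card_le_injP.
exists (fun n => elt (sL (val n))) => m n /(congr1 val) /= e; apply: val_inj.
by have [/s_lt|/s_lt|//] := ltngtP (val m) (val n); rewrite e => /vmem_irr.
Qed.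

(** Each value of [chi] is a member of the supremum [L], so that a sum over the
distinct values is at most the square of [L]. *)
Lemma sum_values_sup (r : range chi -> I) : (forall v, chi (r v) = val v) ->
  [set: {v : range chi & elts (chi (r v))}] #= L.
Proof.
move=> rE; apply: emb_card_eq; last first.
  have /choice[k hk] (x : L) : exists z : {v : range chi & elts (chi (r v))},
      val (projT2 z) = val x.
    have [i _ xi] := set_valP x.
    have vi : range chi (chi i) by exists i.
    have xr : elts (chi (r (elt vi))) (val x) by rewrite rE.
    by exists (existT _ (elt vi) (elt xr)).
  by exists k => x y kxy; apply: val_inj; rewrite -!hk kxy.
have LL : emb (L * L) L.
  apply: square_step.
  - by move=> x [i _]; apply: ord_elt.
  - by move=> x [i _ xi] y yx; exists i => //; apply: ord_trans xi yx.
  - exact: sup_infinite.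
  - by move=> x [i _ xi]; apply: ordinal_square; apply: ord_elt xi.
apply: emb_trans LL.
have vL (v : range chi) : L (val v).
  by have [i _ <-] := set_valP v; have [j ij] := unbounded i; exists j.
have yL v (y : elts (chi (r v))) : L (val y) by exists (r v) => //; apply: set_valP.
exists (fun z => (elt (vL (projT1 z)), elt (yL _ (projT2 z)))).
move=> [v y] [v' y'] [/= /val_inj e]; move: y'; rewrite -e => y' ey.
by congr existT; apply: val_inj.
Qed.

End Supremum.

Theorem lemma3p4 (kappa : V)
    (kappa_regular : is_regular_cardinal kappa)
    (kappa_uncountable : ~ countable (elts kappa))
    (kappa_pow : [set: fun_lt kappa] #= elts kappa)
    (gamma : V)
    (gamma_ord : is_ordinal gamma)
    (gamma_ge1 : ord_le vone gamma)
    (gamma_le : ord_le gamma kappa)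
    (chi : elts gamma -> V)
    (chi_card : forall i, is_cardinal (chi i))
    (chi_neq0 : forall i, chi i <> vzero)
    (phi : elts gamma -> formula)
    (R : elts gamma -> set (H kappa))
    (phi_equiv : forall i, defines_Sigma11_equiv (phi i) (R i))
    (phi_classes : forall i, has_classes (sim (phi i) (R i)) (elts (chi i))) :
  (exists E : pow2 kappa -> pow2 kappa -> Prop,
      is_Sigma11_equiv E /\
      has_classes E (\bigcup_(i in [set: elts gamma]) elts (chi i)))
  /\
  (exists E : pow2 kappa -> pow2 kappa -> Prop,
      is_Sigma11_equiv E /\
      has_classes E [set: forall i : elts gamma, elts (chi i)]).
Proof.
have chi_ord i : is_ordinal (chi i) by case: (chi_card i).
have gamma_small : small kappa (elts gamma).
  apply: emb_subset => x xg; case: gamma_le => [gk|<- //].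
  exact: ord_trans (kappa_ord kappa_regular) gk xg.
have [i0] : inhabited (elts gamma).
  constructor; apply: (@elt _ (elts gamma) vzero).
  have one0 : elts vone vzero by rewrite elts_vone.
  by case: gamma_ge1 => [/(ord_trans gamma_ord)|<- //]; apply.
have c i := cid (has_classes_classifies (phi_equiv i).2 (phi_classes i)).
have analytic_phi i : analytic (sim (phi i) (R i)) by apply: analytic_sim.
have realize (Y : Type) (E : pow2 kappa -> pow2 kappa -> Prop) (d : pow2 kappa -> Y) :
    analytic E -> classifies E d -> is_Sigma11_equiv E /\ has_classes E [set: Y].
  move=> aE Ed; split; last exact: classifies_has_classes Ed.
  by apply: analytic_Sigma11 => //; apply: classifies_equiv Ed.
split; last first.
  have [E [aE [d Ed]]] := analytic_prod kappa_regular kappa_uncountable kappa_pow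
    gamma_small analytic_phi (fun i => projT2 (c i)).
  by exists E; apply: realize Ed.
have [[i e]|nL] := EM (exists j,
    \bigcup_(i in [set: elts gamma]) elts (chi i) = elts (chi j)).
  exists (sim (phi i) (R i)); rewrite e; split=> //.
  by exists (phi i), (R i).
have unbounded : forall i, exists j, vmem (chi i) (chi j).
  by apply: sup_not_attained => // i e; apply: nL; exists i.
have /choice[r rE] (v : range chi) : exists i, chi i = val v.
  by have [i _ <-] := set_valP v; exists i.
have values_small : small kappa (range chi).
  apply: (small_inj (f := r)) gamma_small => v w e; apply: val_inj.
  by rewrite -!rE e.
have v0 : range chi by apply: (@elt _ _ (chi i0)); exists i0.
(* Repeated values would make the sum too large when there are more indices than
elements of the supremum, so one index is kept for each value. *)
have [E [aE [d Ed]]] := analytic_sum kappa_regular kappa_uncountable kappa_pow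
  v0 values_small (fun v => analytic_phi (r v)) (fun v => projT2 (c (r v))).
have [sE cE] := realize _ _ _ aE Ed.
exists E; split=> //; apply: card_eq_trans cE _.
exact: (sum_values_sup i0).
Qed.
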